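(* There exist $\varepsilon_0>0$ and an absolute constant $D>0$ such that for all $\delta\in(0,1]$ and all $\varepsilon\in(0,\varepsilon_0)$, with probability tending to $1$ as $n\to\infty$, the graph $G\sim G(n,\frac{1+\varepsilon}{n})$ has the following property: every set $S$ of vertex-disjoint paths in $G$, each of length at least $\delta/\varepsilon$, covers at most $D\varepsilon^2\delta^{-2}n$ vertices.
   Context: $G(n,p)$ is the Erdős–Rényi random graph on vertex set $[n]$, each pair being an edge independently with probability $p$; $\varepsilon$ and $\delta$ are fixed as $n\to\infty$. A path of length $m$ has $m$ vertices and $m-1$ edges. *)

(* Defs.v *)
From mathcomp Require Import all_boot all_order all_algebra.
From mathcomp Require Import all_classical all_reals all_analysis.
Import Order.TTheory GRing.Theory Num.Theory.
Import numFieldNormedType.Exports.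

Set Implicit Arguments.
Unset Strict Implicit.
Unset Printing Implicit Defensive.

Local Open Scope ring_scope.

Definition pairs n : {set {set 'I_n}} := [set e : {set 'I_n} | #|e| == 2%N].

(* A simple graph on 'I_n is given by its edge set E \subset pairs n. *)
Definition adj n (E : {set {set 'I_n}}) : rel 'I_n :=
  fun u v => [set u; v] \in E.

(* Each pair is an edge with probability p, independently: the weight of a
   graph is the product over all pairs. *)
Definition gnp_weight (R : realType) n (p : R) (E : {set {set 'I_n}}) : R :=
  \prod_(e in pairs n) (if e \in E then p else 1 - p).

Definition gnp_prob (R : realType) n (p : R) (A : {set {set 'I_n}} -> Prop) : R :=
  \sum_(E in powerset (pairs n) | `[< A E >]) gnp_weight p E.

(* A path is the sequence of its vertices, so its length is its size. *)
Definition graph_path n (E : {set {set 'I_n}}) (s : seq 'I_n) : bool :=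
  [&& s != [::], uniq s & sorted (adj E) s].

(* A set of vertex-disjoint paths is necessarily finite; it is listed by S.
   As paths are nonempty, disjointness rules out repetitions in S, and also
   a path listed together with its reversal. *)
Definition disjoint_paths n (E : {set {set 'I_n}}) (S : seq (seq 'I_n)) : bool :=
  all (graph_path E) S && pairwise (fun s t => [disjoint s & t]) S.

Definition covered n (S : seq (seq 'I_n)) : {set 'I_n} :=
  [set v | has (fun s => v \in s) S].

Definition long_paths_cover_at_most (R : realType) n (l b : R)
    (E : {set {set 'I_n}}) : Prop :=
  forall S : seq (seq 'I_n),
    disjoint_paths E S -> (forall s, s \in S -> l <= (size s)%:R) ->
    #|covered S|%:R <= b.

(* Main.v *)
(* Let r be about a third of the required length of the paths.  In a path on 3r
   vertices each of the r middle vertices starts two disjoint arms with r vertices.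
   In G(n, (1 + eps)/n) with eps r <= 1/3 a vertex starts one arm with probability
   O(1/r), by the recursion for the survival of a critical branching process, and
   two disjoint arms with probability O(1/r^2).  Hence the maximal number of
   disjoint paths on 3r vertices has expectation O(n/r^3).  One edge changes this
   number by at most 1, so by the Efron-Stein inequality its variance is at most n,
   and Chebyshev's inequality gives a bound of the same order with probability
   1 - O(1/n).  Long paths are cut into pieces with exactly 3r vertices. *)

Require Import Defs.
From mathcomp Require Import all_boot all_order all_algebra.
From mathcomp Require Import all_classical all_reals all_analysis.
From mathcomp Require Import lra zify.
Import Order.TTheory GRing.Theory Num.Theory.
Import numFieldNormedType.Exports.

Set Implicit Arguments.
Unset Strict Implicit.
Unset Printing Implicit Defensive.

Local Open Scope ring_scope.

(** * Expectation over a random set with independent elements, and variance bounds *)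

Section Expectation.
Variables (R : realFieldType) (X : finType) (p : R).
Hypothesis p01 : 0 <= p <= 1.

Implicit Types (l : seq X) (f g : {set X} -> R).

(** One independent coin with success probability [p] per entry of [l]; the recursion reveals the
    coins one at a time. On a list without repetitions it is the product measure, see
    [expect_powerset]. *)
Fixpoint expect l f : R :=
  if l is e :: l' then
    p * expect l' (fun E => f (e |: E)) + (1 - p) * expect l' f
  else f finset.set0.

Lemma expect_le l f g :
  (forall E : {set X}, {subset E <= l} -> f E <= g E) ->
  expect l f <= expect l g.
Proof.
case/andP: p01 => p0 p1.
elim: l f g => [|e l IH] f g fg /=; first by apply: fg => x; rewrite inE.
apply: lerD; apply: ler_wpM2l; rewrite ?subr_ge0 //; apply: IH => E sE.
  apply: fg => x; rewrite !inE => /orP[->//|/sE ->]; exact: orbT.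
by apply: fg => x /sE; rewrite inE => ->; exact: orbT.
Qed.

Lemma expect_eq l f g :
  (forall E : {set X}, {subset E <= l} -> f E = g E) ->
  expect l f = expect l g.
Proof.
by move=> fg; apply/eqP; rewrite eq_le; apply/andP; split;
  apply: expect_le => E sE; rewrite fg.
Qed.

Lemma expect_linear l f g a :
  expect l (fun E => a * f E + g E) = a * expect l f + expect l g.
Proof. by elim: l f g => [|e l IH] f g //=; rewrite !IH; lra. Qed.

Lemma expect_cst l a : expect l (fun=> a) = a.
Proof. by elim: l => //= e l ->; lra. Qed.

Lemma expectZ l f a : expect l (fun E => a * f E) = a * expect l f.
Proof.
rewrite -[RHS]addr0 -(expect_cst l 0) -expect_linear.
by apply: expect_eq => E _; rewrite addr0.
Qed.

Lemma expectD l f g :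
  expect l (fun E => f E + g E) = expect l f + expect l g.
Proof.
rewrite -[expect l f]mul1r -expect_linear.
by apply: expect_eq => E _; rewrite mul1r.
Qed.

Lemma expect_sum (I : Type) (s : seq I) (F : I -> {set X} -> R) l :
  expect l (fun E => \sum_(i <- s) F i E) = \sum_(i <- s) expect l (F i).
Proof.
elim: s => [|i s IH].
  rewrite big_nil -[RHS](expect_cst l 0).
  by apply: expect_eq => E _; rewrite big_nil.
rewrite big_cons -IH -expectD.
by apply: expect_eq => E _; rewrite big_cons.
Qed.

(** Independence as a Fubini identity: the coins that satisfy [a] may be revealed first. It serves
    to separate the edges at a vertex from all others. *)
Lemma expect_filter (a : pred X) l f :
  expect l f = expect (seq.filter a l) (fun E1 =>
    expect (seq.filter (predC a) l) (fun E2 => f (E1 :|: E2))).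
Proof.
elim: l f => [|e l IH] f /=; first by rewrite finset.setU0.
rewrite (IH f) (IH (fun E => f (e |: E))).
case: (a e) => /=.
  congr (p * _ + _); apply: expect_eq => E1 _; apply: expect_eq => E2 _.
  by rewrite finset.setUA.
rewrite expectD !expectZ.
congr (p * _ + _); apply: expect_eq => E1 _; apply: expect_eq => E2 _.
by rewrite !finset.setUA (finset.setUC [set e]).
Qed.

Lemma expect_hits (K : {set X}) l :
  expect l (fun E => [exists e in K, e \in E]%:R) = 1 - (1 - p) ^+ count (mem K) l.
Proof.
elim: l => [|e l IH] /=.
  rewrite expr0 subrr; case: existsP => // -[x]; by rewrite inE andbF.
case: (boolP (e \in K)) => eK.
  have -> : expect l (fun E : {set X} => [exists e0 in K, e0 \in e |: E]%:R) = 1.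
    rewrite -[RHS](expect_cst l 1); apply: expect_eq => E _.
    suff -> : [exists e0 in K, e0 \in e |: E] by [].
    by apply/existsP; exists e; rewrite eK !inE eqxx.
  by rewrite IH /= exprS; lra.
rewrite add0n -IH.
have -> : expect l (fun E : {set X} => [exists e0 in K, e0 \in e |: E]%:R) =
  expect l (fun E => [exists e in K, e \in E]%:R).
  apply: expect_eq => E _; congr ((_ : bool)%:R); apply: eq_existsb => x.
  rewrite !inE; case: eqP => [->|//]; by rewrite (negbTE eK).
lra.
Qed.

(** Only an inequality, since the probability is 0 when [K] has an element outside [l]; a repeated
    entry would get several chances, hence [uniq]. *)
Lemma expect_subset (K : {set X}) l : uniq l ->
  expect l (fun E => (K \subset E)%:R) <= p ^+ #|K|.
Proof.
case/andP: p01 => p0 p1.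
elim: l K => [|e l IH] K /=.
  rewrite finset.subset0; case: eqP => [->|_] _; last exact: exprn_ge0.
  by rewrite cards0 expr0.
case/andP => el ul.
case: (boolP (e \in K)) => eK.
  have -> : expect l (fun E => (K \subset E)%:R) = 0.
    rewrite -[RHS](expect_cst l 0); apply: expect_eq => E sE.
    case: (boolP (K \subset E)) => // /fintype.subsetP /(_ _ eK) /sE.
    by rewrite (negbTE el).
  rewrite mulr0 addr0 (cardsD1 e K) eK exprS; apply: ler_wpM2l => //.
  under [X in X <= _]expect_eq do rewrite -finset.subDset.
  exact: IH.
have -> : expect l (fun E => (K \subset e |: E)%:R) =
  expect l (fun E => (K \subset E)%:R).
  apply: expect_eq => E _; rewrite -finset.subDset.
  have /finset.setDidPl -> // : [disjoint K & [set e]].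
  by rewrite disjoint_sym disjoints1.
rewrite -mulrDl addrC subrK mul1r; exact: IH.
Qed.

(** Conditioning on the first coin gives Var f = p Var f1 + (1 - p) Var f0 + p (1 - p) (a1 - a0)^2,
    with conditional means a1 and a0. The last term is at most p, so each coin adds at most p. *)
Lemma efron_stein l f :
  (forall e E, `|f (e |: E) - f E| <= 1) ->
  expect l (fun E => f E ^+ 2) - expect l f ^+ 2 <= (size l)%:R * p.
Proof.
case/andP: p01 => p0 p1.
elim: l f => [|e l IH] f lipf /=; first by rewrite subrr mul0r.
set a1 := expect l (fun E => f (e |: E)); set a0 := expect l f.
have /IH : forall e' E, `|f (e |: (e' |: E)) - f (e |: E)| <= 1.
  by move=> e' E; rewrite finset.setUCA.
rewrite -/a1; set b1 := expect l (fun E => f (e |: E) ^+ 2) => h1.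
have := IH f lipf; rewrite -/a0; set b0 := expect l (fun E => f E ^+ 2) => h0.
have d1 : a1 - a0 <= 1.
  rewrite -[leRHS](expect_cst l) lerBlDr -expectD.
  apply: expect_le => E _; have := lipf e E; rewrite ler_norml; lra.
have d2 : a0 - a1 <= 1.
  rewrite -[leRHS](expect_cst l) lerBlDr -expectD.
  apply: expect_le => E _; have := lipf e E; rewrite ler_norml; lra.
have d3 : (a1 - a0) ^+ 2 <= 1 by nra.
have h1' := ler_wpM2l p0 h1.
have q0 : 0 <= 1 - p by lra.
have h0' := ler_wpM2l q0 h0.
have : p * (1 - p) * (a1 - a0) ^+ 2 <= p.
  have -> : p * (1 - p) * (a1 - a0) ^+ 2 = p * ((1 - p) * (a1 - a0) ^+ 2) by lra.
  rewrite ler_piMr //; nra.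
rewrite -natr1 mulrDl mul1r; lra.
Qed.

Lemma expect_chebyshev l f (t v : R) : 0 < t ->
  expect l (fun E => f E ^+ 2) - expect l f ^+ 2 <= v ->
  1 - v / t ^+ 2 <= expect l (fun E => (f E <= expect l f + t)%R%:R).
Proof.
move=> t0; set a := expect l f => hv.
rewrite lerBlDr -lerBlDl.
have -> : 1 - expect l (fun E => (f E <= a + t)%R%:R) =
  expect l (fun E => 1 - (f E <= a + t)%R%:R).
  transitivity (expect l (fun E => -1 * (f E <= a + t)%R%:R + 1)).
    by rewrite expect_linear expect_cst; lra.
  by apply: expect_eq => E _; lra.
rewrite ler_pdivlMr ?exprn_gt0 // mulrC -expectZ.
apply: le_trans hv.
have -> : expect l (fun E => f E ^+ 2) - a ^+ 2 = expect l (fun E => (f E - a) ^+ 2).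
  transitivity (expect l (fun E => (- 2 * a) * f E + (f E ^+ 2 + a ^+ 2))).
    by rewrite expect_linear expectD expect_cst -/a; lra.
  by apply: expect_eq => E _; lra.
apply: expect_le => E _.
case: (boolP (f E <= a + t)) => [_|]; first by rewrite subrr mulr0 sqr_ge0.
rewrite -ltNge => h.
by rewrite subr0 mulr1; nra.
Qed.

(** Ties the recursion to the product weights of [gnp_weight], by splitting the subsets according to
    whether they contain the head of the list. *)
Lemma expect_powerset l f : uniq l ->
  expect l f = \sum_(E in powerset [set:: l])
    (\prod_(e in [set:: l]) (if e \in E then p else 1 - p)) * f E.
Proof.
elim: l f => [|e l IH] f /=.
  move=> _; rewrite finset.set_nil finset.powerset0 big_set1 big_set0 mul1r //.
case/andP => el ul; rewrite !IH //.
have eL : e \notin [set:: l] by rewrite inE.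
rewrite set_cons; set L := [set:: l] in eL *.
rewrite [RHS](bigID (fun E : {set X} => e \in E)) /=; congr (_ + _).
  rewrite big_distrr /=.
  rewrite [RHS](reindex_onto (fun E => e |: E) (fun E => E :\ e)) /=; last first.
    by move=> E /andP[_ eE]; rewrite finset.setD1K.
  apply: eq_big => [E|E].
    rewrite !inE !eqxx /= andbT; apply/idP/andP => [sE|[sE /eqP EE]].
      split; first exact: finset.setUS.
      rewrite finset.setU1K //; apply: contra eL; exact: (fintype.subsetP sE).
    rewrite -EE; apply/fintype.subsetP => x; rewrite !inE.
    case: eqP => //= xe xE; have /(fintype.subsetP sE) : x \in e |: E by rewrite !inE xE orbT.
    by rewrite !inE => /orP[/eqP|].
  rewrite inE => sE.
  rewrite big_setU1 //= !inE eqxx /= mulrA; congr (_ * _ * _).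
  apply: eq_bigr => x xL; rewrite !inE; case: eqP => // xe.
  by rewrite -xe xL in eL.
rewrite big_distrr /=; apply: eq_big => [E|E].
  rewrite !inE; apply/idP/andP => [sE|[sE eE]].
    split; first exact: (fintype.subset_trans sE (finset.subsetU1 _ _)).
    apply: contra eL; exact: (fintype.subsetP sE).
  apply/fintype.subsetP => x xE; have /(fintype.subsetP sE) := xE.
  rewrite !inE => /orP[/eqP xe|//]; by rewrite -xe xE in eE.
rewrite inE => sE.
have eE : e \notin E by apply: contra eL; exact: (fintype.subsetP sE).
by rewrite big_setU1 //= (negbTE eE) mulrA.
Qed.

(* With x = p / (2 - p) one has 1 - p = (1 - x) / (1 + x), whence
   (1 - p)^b >= (1 - b x) / (1 + b x); the bound is the tangent at b x = m to the
   resulting concave function of b, so that it can be averaged over b. *)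
Lemma pow_sub1_bound (m : R) b : 0 <= m ->
  1 - (1 - p) ^+ b <= 2 * (m ^+ 2 + p / (2 - p) * b%:R) / (1 + m) ^+ 2.
Proof.
case/andP: p01 => p0 p1 m0.
set x := p / (2 - p).
have x0 : 0 <= x by apply: divr_ge0 => //; lra.
have px : (1 - p) * (1 + x) = 1 - x.
  have : x * (2 - p) = p by rewrite /x divfK //; lra.
  lra.
(* This is (1 - p)^b >= (1 - b x) / (1 + b x) with the denominator cleared; in the induction a
   factor 1 + x turns 1 - p into 1 - x. *)
have key : 2 <= (1 + x * b%:R) * (1 + (1 - p) ^+ b).
  elim: b => [|b IH]; first by rewrite mulr0 expr0; lra.
  have z0 : 0 <= (1 - p) ^+ b by apply: exprn_ge0; lra.
  have z1 : (1 - p) ^+ b <= 1 by apply: exprn_ile1; lra.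
  set z := (1 - p) ^+ b in IH z0 z1 *.
  rewrite -(ler_pM2r (_ : 0 < 1 + x)); last lra.
  rewrite exprSr -/z -[b.+1%:R]natr1.
  have -> : (1 + x * (b%:R + 1)) * (1 + z * (1 - p)) * (1 + x) =
    (1 + x * (b%:R + 1)) * (1 + x + z * ((1 - p) * (1 + x))) by lra.
  rewrite px.
  have xb : 0 <= x * b%:R by apply: mulr_ge0.
  have := mulr_ge0 (mulr_ge0 xb x0) (_ : 0 <= 1 - z).
  have := mulr_ge0 (mulr_ge0 x0 x0) (_ : 0 <= 1 - z).
  by move=> /(_ ltac:(lra)) ? /(_ ltac:(lra)) ?; nra.
set y := x * b%:R in key *.
have y0 : 0 <= y by apply: mulr_ge0.
have z1 : 1 - (1 - p) ^+ b <= 2 - 2 / (1 + y).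
  have : 2 / (1 + y) <= 1 + (1 - p) ^+ b.
    by rewrite ler_pdivrMr 1?mulrC //; lra.
  lra.
apply: (le_trans z1).
rewrite ler_pdivlMr; last nra.
set w := 2 / (1 + y); have w0 : w * (1 + y) = 2 by rewrite /w divfK //; lra.
rewrite -(ler_pM2r (_ : 0 < 1 + y)); last lra.
have -> : (2 - w) * (1 + m) ^+ 2 * (1 + y) =
  (2 * (1 + y) - w * (1 + y)) * (1 + m) ^+ 2 by lra.
(* The two sides differ by 2 (m - y)^2, which reflects the tangency at y = m. *)
rewrite w0; have := mulr_ge0 (ler0n R 2) (sqr_ge0 (m - y)); lra.
Qed.

End Expectation.

(** * Arms in the random graph and their probabilities *)

Section Arms.
Variable n : nat.
Implicit Types (E : {set {set 'I_n}}) (D q : seq 'I_n) (u v w : 'I_n).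

Definition avoid D E := [set e in E | [disjoint e & D]].

Lemma avoidS D E1 E2 : E1 \subset E2 -> avoid D E1 \subset avoid D E2.
Proof.
move=> sE; apply/fintype.subsetP => e; rewrite !inE => /andP[eE ->].
by rewrite (fintype.subsetP sE).
Qed.

Lemma avoid_sub D E : avoid D E \subset E.
Proof. by apply/fintype.subsetP => e; rewrite inE => /andP[]. Qed.

Lemma avoid_cons v D E : avoid (v :: D) E = avoid D (avoid [:: v] E).
Proof.
apply/setP => e; rewrite !inE ![[disjoint e & _]]disjoint_sym !disjoint_cons.
by rewrite disjoint0 andbT andbA.
Qed.

Lemma path_avoid D E v q : [disjoint v :: q & D] ->
  path (adj E) v q -> path (adj (avoid D E)) v q.
Proof.
rewrite disjoint_has -all_predC; apply: sub_in_path => x y /= xD yD xy.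
rewrite /adj inE; apply/andP; split=> //; rewrite disjoint_subset.
by apply/fintype.subsetP => z; rewrite !inE => /orP[] /eqP ->.
Qed.

(* Some path of [s] edges starts at [v], and [P] still holds after deletion of
   all edges at its first [s] vertices. *)
Fixpoint arm s (P : pred {set {set 'I_n}}) v E : bool :=
  if s is s'.+1 then
    [exists u, ([set v; u] \in E) && arm s' P u (avoid [:: v] E)]
  else P E.

Definition increasing_event (P : pred {set {set 'I_n}}) :=
  forall E1 E2, E1 \subset E2 -> P E1 -> P E2.

Lemma increasing_arm s P v : increasing_event P -> increasing_event (arm s P v).
Proof.
move=> incP; elim: s v => [//|s IH] v E1 E2 sE /= /existsP[u /andP[uE au]].
apply/existsP; exists u; rewrite (fintype.subsetP sE) //=.
exact: IH (avoidS _ sE) au.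
Qed.

Lemma arm_event s P v E : increasing_event P -> arm s P v E -> P E.
Proof.
move=> incP; elim: s v E => [//|s IH] v E /= /existsP[u /andP[_ /IH]].
exact/incP/avoid_sub.
Qed.

(** The arm deletes only its first [s] vertices, while [P] is assumed after deletion of the whole
    path; monotonicity of [P] bridges the two. *)
Lemma path_arm s P v q E : increasing_event P -> path (adj E) v q ->
  uniq (v :: q) -> (s <= size q)%N -> P (avoid (v :: q) E) -> arm s P v E.
Proof.
move=> incP; elim: q s v E => [|w q IH] [|s] v E //.
- by move=> _ _ _; apply/incP/avoid_sub.
- by move=> _ _ _; apply/incP/avoid_sub.
move=> /= /andP[vw wq] /andP[vq uq] sq Pq.
apply/existsP; exists w; rewrite [_ \in _]vw /=.
apply: IH => //; last by rewrite -avoid_cons.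
apply: path_avoid => //; rewrite disjoint_sym disjoint_cons disjoint0 andbT //.
Qed.

(** The second arm is the event required after the first: it uses the edges left once [v] and the
    first [s] vertices of the arm from [u] are deleted. Nesting thus makes the arms
    edge-disjoint. *)
Definition two_arms s v E :=
  [exists u, exists w, [&& u != w, [set v; u] \in E, [set v; w] \in E &
    arm s (arm s predT w) u (avoid [:: v] E)]].

(** The part before [v], reversed, gives the first arm and the part after [v] the second; the strict
    inequalities pay for the neighbours of [v] where the arms start. *)
Lemma path_two_arms s v (l r : seq 'I_n) E :
  sorted (adj E) (l ++ v :: r) -> uniq (l ++ v :: r) ->
  (s < size l)%N -> (s < size r)%N -> two_arms s v E.
Proof.
case/lastP: l => [//|l u]; case: r => [//|w r].
rewrite size_rcons /= !ltnS => so un sl sr.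
have symE : symmetric (adj E) by move=> x y; rewrite /adj finset.setUC.
have [sol _] := cat_sorted2 so.
have := so; rewrite cat_rcons => /cat_sorted2[_ /= /and3P[uv vw wr]].
have := un; rewrite cat_uniq /= => /and3P[ul /norP[vl /norP[wl dis]]].
rewrite inE => /andP[/norP[vw' vr] /andP[wr' ur]].
have lu_path : path (adj E) u (rev l).
  move: sol; rewrite -rev_sorted rev_rcons /=.
  by rewrite (eq_path (e' := adj E)) // => x y; rewrite symE.
have ulr : uniq (u :: rev l) by rewrite -rev_rcons rev_uniq.
have mulr x : (x \in u :: rev l) = (x \in rcons l u) by rewrite -rev_rcons mem_rev.
apply/existsP; exists u; apply/existsP; exists w; apply/and4P; split.
- apply: contraNneq wl => <-; by rewrite mem_rcons inE eqxx.
- by rewrite finset.setUC.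
- exact: vw.
apply: (@path_arm _ _ _ (rev l)) => //.
- exact: increasing_arm.
- by apply: path_avoid => //; rewrite disjoint_sym disjoint_cons disjoint0 andbT mulr.
- by rewrite size_rev.
rewrite -avoid_cons.
apply: (@path_arm _ _ _ r) => //; last by rewrite /= wr'.
apply: path_avoid => //; rewrite disjoint_sym disjoint_cons inE negb_or vw' vr /=.
rewrite disjoint_sym disjoint_cons mulr wl /= disjoint_sym disjoint_has.
by apply: contra dis => /hasP[x]; rewrite mulr => xl xr; apply/hasP; exists x.
Qed.

Variables (R : realFieldType) (p : R).
Hypothesis p01 : 0 <= p <= 1.

(* The choice of m makes [pow_sub1_bound] tight at b = n c, where c is the
   previous value; 2 m / (1 + m) is then its right-hand side. *)
Fixpoint arm_bound s : R :=
  if s is s'.+1 then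
    let m := p / (2 - p) * n%:R * arm_bound s' in 2 * m / (1 + m)
  else 1.

Lemma arm_bound_ge0 s : 0 <= arm_bound s.
Proof.
case/andP: p01 => p0 p1.
elim: s => //= s IH.
have m0 : 0 <= p / (2 - p) * n%:R * arm_bound s.
  by apply: mulr_ge0 => //; apply: mulr_ge0 => //; apply: divr_ge0 => //; lra.
by apply: divr_ge0; [apply: mulr_ge0|apply: addr_ge0].
Qed.

(** With z = n p / (2 - p), the reciprocals satisfy 1/c' = 1/2 + 1/(2 z c) >= 1/2 + b/c, so they
    grow linearly up to the factor b^s. The product form avoids dividing by a bound that may
    vanish. *)
Lemma arm_bound_decay b s : 0 <= b <= 1 -> b * (2 * (p / (2 - p) * n%:R)) <= 1 ->
  arm_bound s * (b ^+ s * (1 + s%:R / 2)) <= 1.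
Proof.
case/andP: p01 => p0 p1 /andP[b0 b1] ab.
elim: s => [|s IH] /=; first by rewrite expr0; lra.
have c0 := arm_bound_ge0 s.
set c := arm_bound s in IH c0 *.
set z := p / (2 - p) * n%:R in ab *.
have z0 : 0 <= z by apply: mulr_ge0 => //; apply: divr_ge0 => //; lra.
set m := z * c; have m0 : 0 <= m by apply: mulr_ge0.
set d := b ^+ s * (1 + s%:R / 2) in IH.
have d0 : 0 <= d by apply: mulr_ge0; [exact: exprn_ge0|have := ler0n R s; lra].
have -> : b ^+ s.+1 * (1 + s.+1%:R / 2) = b * d + b ^+ s.+1 / 2.
  by rewrite /d -[s.+1%:R]natr1 exprS; lra.
have : b ^+ s.+1 <= 1 by exact: exprn_ile1.
set g := b ^+ s.+1 => g1.
rewrite mulrAC ler_pdivrMr; last lra.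
have h1 : (b * (2 * z)) * (c * d) <= 1.
  rewrite -[leRHS]mulr1; apply: ler_pM => //; last exact: mulr_ge0.
  by apply: mulr_ge0 => //; apply: mulr_ge0.
have h2 : m * g <= m by rewrite ler_piMr.
by rewrite /m in h2 *; lra.
Qed.

(* The event [P] allows the bound to be applied a second time, to an arm
   disjoint from the first one; this replaces the BK inequality. *)
Lemma expect_arm s P (Q : R) T v : increasing_event P -> 0 <= Q ->
  (forall T', uniq T' -> expect p T' (fun E => (P E)%:R) <= Q) -> uniq T ->
  expect p T (fun E => (arm s P v E)%:R) <= Q * arm_bound s.
Proof.
case/andP: (p01) => p0 p1 incP Q0 PQ.
elim: s T v => [|s IH] T v uT /=; first by rewrite mulr1; exact: PQ.
set x := p / (2 - p); set m := x * n%:R * arm_bound s.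
have x0 : 0 <= x by apply: divr_ge0 => //; lra.
have m0 : 0 <= m.
  by apply: mulr_ge0; [apply: mulr_ge0|exact: arm_bound_ge0].
(* The edges [T2] that miss [v] are revealed before the edges [T1] at [v]. *)
rewrite (expect_filter p01 (fun e : {set 'I_n} => v \notin e)).
set T2 := seq.filter _ _; set T1 := seq.filter _ _.
have uT2 : uniq T2 by exact: filter_uniq.
have uT1 : uniq T1 by exact: filter_uniq.
pose k := 2 / (1 + m) ^+ 2.
have k0 : 0 <= k by apply: divr_ge0 => //; exact: sqr_ge0.
have step : forall E2 : {set {set 'I_n}}, {subset E2 <= T2} ->
    expect p T1 (fun E1 =>
      [exists u, ([set v; u] \in E2 :|: E1) &&
        arm s P u (avoid [:: v] (E2 :|: E1))]%:R) <=
    k * (m ^+ 2 * (P E2)%:R + x * \sum_u (arm s P u E2)%:R).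
  move=> E2 sE2.
  (* Once [E2] is known, an arm from [v] needs an edge of [T1] to a vertex that starts an arm in
     [E2]; [K] collects these edges. *)
  pose K := [set [set v; u] | u in [set u | arm s P u E2]].
  have cK : (count (mem K) T1 <= \sum_u arm s P u E2)%N.
    rewrite -size_filter; apply: (@leq_trans #|K|).
      rewrite cardE; apply: uniq_leq_size; first exact: filter_uniq.
      by move=> e; rewrite mem_filter mem_enum => /andP[].
    apply: (leq_trans (leq_imset_card _ _)).
    rewrite cardsE -sum1_card big_mkcond /=.
    by apply: leq_sum => u _; rewrite unfold_in; case: arm.
  apply: (@le_trans _ _ (1 - (1 - p) ^+ count (mem K) T1)).
    rewrite -(expect_hits p01 K T1); apply: expect_le => // E1 sE1.
    rewrite ler_nat; case: existsP => //= -[u /andP[uE au]].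
    suff -> : [exists e in K, e \in E1] by [].
    have av : avoid [:: v] (E2 :|: E1) = E2.
      apply/setP => e; rewrite !inE disjoint_sym disjoint_cons disjoint0 andbT.
      case: (boolP (e \in E2)) => [/sE2|_] /=; first by rewrite mem_filter => /andP[].
      by apply/negP => /andP[/sE1]; rewrite mem_filter /= negbK => /andP[->].
    apply/existsP; exists [set v; u]; apply/andP; split.
      by apply/imsetP; exists u => //; rewrite inE -av.
    move: uE; rewrite inE => /orP[/sE2|//].
    by rewrite mem_filter !inE eqxx.
  (* Keeping the factor [P E2] on the constant term m^2 of the tangent bound makes its average at
     most m^2 Q. If [P E2] fails, no arm exists and [K] is empty. *)
  have [PE|PE] := boolP (P E2).
    rewrite mulr1; apply: (le_trans (pow_sub1_bound p01 _ m0)).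
    rewrite mulrAC -/k; apply: ler_wpM2l => //; rewrite lerD2l; apply: ler_wpM2l => //.
    by rewrite -natr_sum ler_nat.
  have c0 : count (mem K) T1 = 0%N.
    apply/eqP; rewrite -leqn0 (leq_trans cK) // leqn0 sum_nat_eq0.
    apply/forallP => u; apply/implyP => _; rewrite eqb0.
    by apply: contra PE; exact: arm_event.
  rewrite c0 expr0 subrr; apply: mulr_ge0 => //; rewrite mulr0 add0r.
  by apply: mulr_ge0 => //; apply: sumr_ge0.
apply: (le_trans (expect_le p01 step)).
rewrite (expectZ p01) (expectD p01) !(expectZ p01) (expect_sum p01).
have h1 := PQ _ uT2.
have h2 : \sum_u expect p T2 (fun E => (arm s P u E)%:R) <=
    n%:R * (Q * arm_bound s).
  apply: (@le_trans _ _ (\sum_(u < n) (Q * arm_bound s))).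
    by apply: ler_sum => u _; exact: IH.
  by rewrite sumr_const card_ord mulr_natl.
apply: (@le_trans _ _ (k * (m ^+ 2 * Q + x * (n%:R * (Q * arm_bound s))))).
  apply: ler_wpM2l => //; apply: lerD; apply: ler_wpM2l => //; exact: sqr_ge0.
have -> : x * (n%:R * (Q * arm_bound s)) = Q * m by rewrite /m; lra.
have w0 : 1 + m != 0 by rewrite gt_eqF //; lra.
have -> : k * (m ^+ 2 * Q + Q * m) = Q * (2 * m * ((1 + m) / (1 + m) ^+ 2)).
  by rewrite /k; lra.
by rewrite (_ : _ / _ = (1 + m)^-1) // expr2 invfM mulrA divff // mul1r.
Qed.

(** Union bound over the n^2 pairs of neighbours: the two edges at [v] cost p^2, independently of
    the arms, and each of the nested arms costs one factor [arm_bound s]. *)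
Lemma expect_two_arms s v T : uniq T ->
  expect p T (fun E => (two_arms s v E)%:R) <= (n%:R * p * arm_bound s) ^+ 2.
Proof.
case/andP: (p01) => p0 p1 uT.
have c0 := arm_bound_ge0 s.
pose A u w E := [&& u != w, [set v; u] \in E, [set v; w] \in E &
    arm s (arm s predT w) u (avoid [:: v] E)].
have step u w : expect p T (fun E => (A u w E)%:R) <= p ^+ 2 * (arm_bound s) ^+ 2.
  have [uw|uw] := eqVneq u w.
    rewrite -(expect_cst p T (p ^+ 2 * arm_bound s ^+ 2)); apply: expect_le => // E _.
    by rewrite /A uw eqxx /=; apply: mulr_ge0; exact: sqr_ge0.
  rewrite (expect_filter p01 (fun e : {set 'I_n} => v \notin e)).
  set T2 := seq.filter _ _; set T1 := seq.filter _ _.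
  have uT2 : uniq T2 by exact: filter_uniq.
  have uT1 : uniq T1 by exact: filter_uniq.
  apply: (@le_trans _ _
    (expect p T2 (fun E2 => p ^+ 2 * (arm s (arm s predT w) u E2)%:R))).
    apply: expect_le => // E2 sE2.
    pose K := [set [set v; u]; [set v; w]].
    apply: (@le_trans _ _ (expect p T1 (fun E1 =>
      (arm s (arm s predT w) u E2)%:R * (K \subset E1)%:R))).
      apply: expect_le => // E1 sE1; rewrite -natrM mulnb ler_nat /A uw /=.
      have av : avoid [:: v] (E2 :|: E1) = E2.
        apply/setP => e; rewrite !inE disjoint_sym disjoint_cons disjoint0 andbT.
        case: (boolP (e \in E2)) => [/sE2|_] /=; first by rewrite mem_filter => /andP[].
        by apply/negP => /andP[/sE1]; rewrite mem_filter /= negbK => /andP[->].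
      have memE1 z : ([set v; z] \in E2 :|: E1) = ([set v; z] \in E1).
        rewrite inE; case: (boolP (_ \in E2)) => // /sE2.
        by rewrite mem_filter !inE eqxx.
      rewrite av !memE1 finset.subUset !finset.sub1set.
      by case: arm; rewrite ?andbF ?andbT.
    rewrite (expectZ p01) mulrC; apply: ler_wpM2r => //.
    apply: (le_trans (expect_subset p01 K uT1)).
    rewrite cards2 (_ : [set v; u] != [set v; w]) //.
    apply: contraNneq uw => /setP uvw.
    have := uvw u; have := uvw w; rewrite !inE !eqxx !orbT /=.
    case: (eqVneq w v) => [-> _|_ /= /eqP-> //].
    by case: (eqVneq u v).
  rewrite (expectZ p01); apply: ler_wpM2l; first exact: sqr_ge0.
  (* The outer arm is bounded with the inner one as its event [P] and [Q] equal to [arm_bound s];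
     the inner arm then has event [predT] and [Q] equal to 1. *)
  rewrite expr2; apply: expect_arm => //; first exact: increasing_arm.
  move=> T' uT'; rewrite -[leRHS]mul1r; apply: expect_arm => // T'' _.
  by rewrite expect_cst.
apply: (@le_trans _ _ (expect p T (fun E => \sum_u \sum_w (A u w E)%:R))).
  apply: expect_le => // E _; have [/existsP[u /existsP[w Auw]]|_] := boolP (two_arms s v E).
    rewrite (bigD1 u) //= (bigD1 w) //= /A Auw -addrA lerDl.
    by apply: addr_ge0; apply: sumr_ge0 => // ? _; apply: sumr_ge0.
  by apply: sumr_ge0 => ? _; apply: sumr_ge0.
rewrite (expect_sum p01).
apply: (@le_trans _ _ (\sum_(u < n) \sum_(w < n) (p ^+ 2 * arm_bound s ^+ 2))).
  apply: ler_sum => u _; rewrite (expect_sum p01); apply: ler_sum => w _; exact: step.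
rewrite !sumr_const card_ord -mulrnA -[in leLHS]mulr_natl natrM; lra.
Qed.

End Arms.

(** * Packings of disjoint paths with equally many vertices *)

Lemma subseq_flatten (T : eqType) (f : seq T -> seq T) (S : seq (seq T)) :
  (forall s, subseq (f s) s) -> subseq (flatten (map f S)) (flatten S).
Proof. by move=> sf; elim: S => //= s S IH; exact: cat_subseq. Qed.

Lemma count_mem_flatten (T : eqType) (x : T) (S : seq (seq T)) :
  (count (fun s => x \in s) S <= count_mem x (flatten S))%N.
Proof.
elim: S => //= s S IH; rewrite count_cat leq_add // -has_pred1 has_count.
by case: count.
Qed.

Section Packing.
Variables n k : nat.
Implicit Types (E : {set {set 'I_n}}) (e : {set 'I_n}) (s : seq 'I_n)
  (S : seq (seq 'I_n)).

(** One [uniq] for the concatenation says both that each path is simple and that the paths are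
    disjoint. *)
Definition packing E S :=
  [&& uniq (flatten S), all (fun s => size s == k) S & all (sorted (adj E)) S].

(** The range up to [n] loses nothing when k > 0, since there are at most n disjoint nonempty
    paths. *)
Definition max_packing E : nat :=
  \max_(m < n.+1 | `[< exists2 S, packing E S & size S = m >]) m.

Lemma size_flatten_const S :
  all (fun s => size s == k) S -> size (flatten S) = (k * size S)%N.
Proof.
by elim: S => [|s S IH] /=; rewrite ?muln0 // size_cat mulnS => /andP[/eqP-> /IH->].
Qed.

Lemma size_packing E S : (0 < k)%N -> packing E S -> (size S <= max_packing E)%N.
Proof.
move=> k0 pS; have /and3P[uS /size_flatten_const sS _] := pS.
have Sn : (size S < n.+1)%N.
  rewrite ltnS (leq_trans (leq_pmull _ k0)) // -sS.
  by have := max_card (mem (flatten S)); rewrite (card_uniqP uS) card_ord.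
apply: (@bigop.bigmax_sup _ (Ordinal Sn)) => //.
by apply/asboolP; exists S.
Qed.

Lemma max_packingP E : exists2 S, packing E S & size S = max_packing E.
Proof.
pose A := [pred m : 'I_n.+1 | `[< exists2 S, packing E S & size S = m >]].
have A0 : (0 < #|A|)%N.
  by apply/card_gt0P; exists ord0; rewrite unfold_in /=; apply/asboolP; exists [::].
have [m mA mE] := eq_bigmax_cond (@nat_of_ord n.+1) A0.
move: mA; rewrite unfold_in => /asboolP[S pS sS]; exists S => //.
by rewrite sS -mE; apply: eq_bigl => i; rewrite inE.
Qed.

Lemma max_packingS E1 E2 : (0 < k)%N -> E1 \subset E2 ->
  (max_packing E1 <= max_packing E2)%N.
Proof.
move=> k0 sE; have [S /and3P[uS kS aS] <-] := max_packingP E1.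
apply: size_packing => //; rewrite /packing uS kS /=.
apply: sub_all aS => s; apply: sub_sorted => x y; exact: (fintype.subsetP sE).
Qed.

Lemma sorted_new_edge e E s : sorted (adj (e |: E)) s -> ~~ sorted (adj E) s ->
  exists2 x, x \in e & forall y, y \in e -> y \in s.
Proof.
move=> sEs; apply: contraNP => ne.
apply: (sub_in_sorted (P := mem s) _ _ sEs); last exact/allP.
move=> x y xs ys; rewrite /adj !inE => /orP[/eqP xy|//].
exfalso; apply: ne; exists x; first by rewrite -xy !inE eqxx.
by move=> z; rewrite -xy !inE => /orP[] /eqP->.
Qed.

(** The paths of a packing that need [e] all contain a common end of [e], so there is at most one;
    dropping it leaves a packing in [E]. *)
Lemma max_packing_setU1 e E : (0 < k)%N ->
  (max_packing (e |: E) <= (max_packing E).+1)%N.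
Proof.
move=> k0; have [S /and3P[uS kS aS] <-] := max_packingP (e |: E).
pose a s := sorted (adj E) s.
have sub : subseq (flatten (seq.filter a S)) (flatten S).
  elim: (S) => //= s S' IH; case: (a s) => /=; first exact: cat_subseq.
  exact: subseq_trans IH (suffix_subseq _ _).
have : (size (seq.filter a S) <= max_packing E)%N.
  apply: size_packing => //; apply/and3P; split.
  - exact: subseq_uniq sub uS.
  - by apply/allP => s; rewrite mem_filter => /andP[_ /(allP kS)].
  - by apply/allP => s; rewrite mem_filter => /andP[].
rewrite -(count_predC a S) size_filter => h.
suff : (count (predC a) S <= 1)%N by lia.
have [/hasP[s sS as0]|] := boolP (has (predC a) S); last first.
  by rewrite has_count -leqNgt => /leq_trans; apply.
have [x xe _] := sorted_new_edge (allP aS _ sS) as0.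
apply: (@leq_trans (count (fun s => x \in s) S)).
  rewrite (eq_in_count (a2 := predI (fun s => x \in s) (predC a))).
    by apply: sub_count => s' /andP[].
  move=> s' s'S /=; rewrite andbC; case: (boolP (a s')) => //= as'.
  by have [_ _ ->] := sorted_new_edge (allP aS _ s'S) as'.
by rewrite (leq_trans (count_mem_flatten x S)) // count_uniq_mem // leq_b1.
Qed.

Lemma chop_path E m s : (m * k <= size s)%N -> sorted (adj E) s ->
  exists S, [/\ size S = m, subseq (flatten S) s,
    all (fun s => size s == k) S & all (sorted (adj E)) S].
Proof.
elim: m s => [|m IH] s ms so; first by exists [::]; rewrite sub0seq.
have [||S [sS subS kS aS]] := IH (drop k s).
- by rewrite size_drop; move: ms; rewrite mulSn; lia.
- exact: drop_sorted.
exists (take k s :: S); split => /=; first by rewrite sS.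
- by rewrite -[s in X in subseq _ X](cat_take_drop k); exact: cat_subseq.
- by rewrite kS size_takel ?eqxx //; move: ms; rewrite mulSn; lia.
- by rewrite aS take_sorted.
Qed.

Lemma uniq_flatten_disjoint_paths E S : disjoint_paths E S -> uniq (flatten S).
Proof.
rewrite /disjoint_paths; elim: S => //= s S IH.
move=> /andP[/andP[/and3P[_ us _] gS] /andP[dS pS]].
rewrite cat_uniq us IH ?gS ?pS // andbT; apply/hasPn => x /flattenP[t tS xt].
by apply/negP => xs; have := disjointFr (allP dS _ tS) xs; rewrite xt.
Qed.

(** A path with q k + z vertices, where q >= 1 and z < k, is cut into q pieces and has fewer than 2
    q k vertices; hence the factor 2. *)
Lemma covered_le E S : (0 < k)%N -> disjoint_paths E S ->
  (forall s, s \in S -> (k <= size s)%N) ->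
  (#|covered S| <= 2 * k * max_packing E)%N.
Proof.
move=> k0 dS lS; have uS := uniq_flatten_disjoint_paths dS.
have [S' [sub kS' aS' sz]] : exists S', [/\ subseq (flatten S') (flatten S),
    all (fun s => size s == k) S', all (sorted (adj E)) S' &
    (size (flatten S) <= 2 * k * size S')%N].
  move: dS => /andP[gS _]; elim: S lS gS {uS} => [|s S IH] lS /=.
    by move=> _; exists [::].
  case/andP => /and3P[_ _ so] gS.
  have [|S2 [sub2 k2 a2 sz2]] := IH _ gS.
    by move=> t tS; apply: lS; rewrite inE tS orbT.
  have [S1 [sz1 sub1 k1 a1]] := chop_path (leq_divM (size s) k) so.
  exists (S1 ++ S2); rewrite flatten_cat !all_cat k1 k2 a1 a2 cat_subseq //.
  split=> //; rewrite !size_cat mulnDr leq_add // sz1.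
  have ks : (k <= size s)%N by apply: lS; rewrite mem_head.
  have := divn_eq (size s) k; have := ltn_pmod (size s) k0.
  have : (0 < size s %/ k)%N by rewrite divn_gt0.
  by set q := (_ %/ _)%N; set z := (_ %% _)%N; nia.
have /size_packing : packing E S' by rewrite /packing kS' aS' (subseq_uniq sub).
move=> /(_ k0) h.
apply: (@leq_trans (2 * k * size S')); last by rewrite leq_mul2l h orbT.
apply: leq_trans sz; rewrite -(card_uniqP uS); apply/subset_leq_card.
apply/fintype.subsetP => v; rewrite !inE => /hasP[s sS vs].
by apply/flattenP; exists s.
Qed.

End Packing.

(** A vertex in the middle third has at least [t.+1] path vertices on each side: a neighbour and an
    arm of [t] edges. Middle thirds of different paths are disjoint, so no vertex is counted
    twice. *)
Lemma max_packing_two_arms n t (E : {set {set 'I_n}}) :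
  (t.+1 * max_packing (3 * t.+1) E <= \sum_v two_arms t v E)%N.
Proof.
have [S /and3P[uS kS aS] <-] := max_packingP (3 * t.+1) E.
pose mid (s : seq 'I_n) := take t.+1 (drop t.+1 s).
have sub : subseq (flatten (map mid S)) (flatten S).
  apply: subseq_flatten => s.
  exact: subseq_trans (take_subseq _ _) (drop_subseq _ _).
have -> : (t.+1 * size S = size (flatten (map mid S)))%N.
  rewrite -(size_map mid) (size_flatten_const (k := t.+1)) // all_map; apply/allP => s sS.
  by rewrite /= size_takel // size_drop (eqP (allP kS _ sS)); lia.
apply: (@leq_trans #|[set v | two_arms t v E]|); last first.
  rewrite cardsE -sum1_card big_mkcond /=.
  by apply: leq_sum => v _; rewrite unfold_in -/(two_arms t v E); case: (two_arms t v E).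
rewrite cardE; apply: uniq_leq_size; first exact: subseq_uniq sub uS.
move=> v /flattenP[_ /mapP[s sS ->] /(nthP v)[j]].
have ks := eqP (allP kS _ sS).
rewrite size_takel; last by rewrite size_drop ks; lia.
move=> jt; rewrite nth_take // nth_drop => vj.
have js : (t.+1 + j < size s)%N by rewrite ks; lia.
have es : s = take (t.+1 + j) s ++ v :: drop (t.+1 + j).+1 s.
  by rewrite -[LHS](cat_take_drop (t.+1 + j)) (drop_nth v) // vj.
rewrite mem_enum inE.
apply: (@path_two_arms _ t v (take (t.+1 + j) s) (drop (t.+1 + j).+1 s)).
- by rewrite -es; exact: (allP aS).
- rewrite -es; apply: subseq_uniq uS; elim: (S) sS => //= s' S' IH.
  rewrite inE => /orP[/eqP->|/IH h]; first exact: prefix_subseq.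
  exact: subseq_trans h (suffix_subseq _ _).
- by rewrite size_takel; lia.
- by rewrite size_drop ks; lia.
Qed.

(** * The near-critical range: mean and upper tail of the packing number *)

Lemma bernoulli (R : realFieldType) (y : R) t : 0 <= y <= 1 ->
  1 - t%:R * y <= (1 - y) ^+ t.
Proof.
case/andP=> y0 y1; elim: t => [|t IH]; first by rewrite expr0; lra.
have q0 : 0 <= 1 - y by lra.
have := ler_wpM2l q0 IH; rewrite exprS -[t.+1%:R]natr1.
have := mulr_ge0 (ler0n R t) (sqr_ge0 y); lra.
Qed.

Lemma card_pairs n : (#|pairs n| * 2 = n * n.-1)%N.
Proof.
have -> : #|pairs n| = 'C(n, 2) by rewrite card_draws card_ord.
rewrite bin2 muln2 -[RHS](odd_double_half (n * n.-1)) oddM.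
by case: n => //= n; rewrite andNb.
Qed.

Lemma gnp_prob_expect (R : realType) n (p : R) (A : {set {set 'I_n}} -> Prop) :
  0 <= p <= 1 ->
  gnp_prob p A = expect p (enum (pairs n)) (fun E => `[< A E >]%:R).
Proof.
move=> p01; rewrite expect_powerset ?enum_uniq //.
have -> : [set:: enum (pairs n)] = pairs n by apply/setP => e; rewrite inE mem_enum.
rewrite /gnp_prob big_mkcondr /=; apply: eq_bigr => E _.
by case: asboolP => _; rewrite ?mulr1 ?mulr0.
Qed.

Section Tail.
Variables (R : realFieldType) (n t : nat) (eps : R).
Hypotheses (eps01 : 0 < eps <= 1) (epst : eps * t.+1%:R <= 3^-1)
  (n_large : 3 / eps <= n%:R).

Let p := (1 + eps) / n%:R.

Lemma vertices_gt0 : 0 < n%:R :> R.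
Proof.
case/andP: eps01 => e0 e1; apply: lt_le_trans n_large; exact: divr_gt0.
Qed.

Lemma edge_prob_mul : n%:R * p = 1 + eps.
Proof. by rewrite mulrC divfK // gt_eqF // vertices_gt0. Qed.

Lemma edge_prob_le : p <= 2 / 3 * eps.
Proof.
case/andP: eps01 => e0 e1.
rewrite ler_pdivrMr ?vertices_gt0 //; move: n_large; rewrite ler_pdivrMr //; lra.
Qed.

Lemma edge_prob01 : 0 <= p <= 1.
Proof.
case/andP: eps01 => e0 e1; have := edge_prob_le => h; apply/andP; split; last lra.
apply: divr_ge0; [lra|exact: ler0n].
Qed.

Lemma near_critical_arm_bound : arm_bound n p t * t.+1%:R <= 6.
Proof.
case/andP: eps01 => e0 e1; have /andP[p0 p1] := edge_prob01.
(* With this [b] the decay hypothesis becomes p (1 + 2 eps) <= 2 eps, which holds as p <= 2 eps / 3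
   and eps <= 1. *)
pose b := (1 + 2 * eps)^-1.
have bE : b * (1 + 2 * eps) = 1 by rewrite mulVf // gt_eqF //; lra.
have b0 : 0 <= b by rewrite invr_ge0; lra.
have b1 : b <= 1 by rewrite invf_le1; lra.
have be : 1 - b <= 2 * eps by nra.
have h : b * (2 * (p / (2 - p) * n%:R)) <= 1.
  have -> : p / (2 - p) * n%:R = (1 + eps) / (2 - p).
    by rewrite -edge_prob_mul; lra.
  rewrite -bE; apply: ler_wpM2l => //; rewrite mulrA ler_pdivrMr; last lra.
  have := edge_prob_le; nra.
(* Bernoulli gives b^t >= 1 - 2 eps t >= 1/3 by [epst]. Then c (1 + t/2) <= 3, which is the source
   of the 6. *)
have bt : 3^-1 <= b ^+ t.
  have : 1 - t%:R * (1 - b) <= b ^+ t.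
    have := @bernoulli R (1 - b) t; rewrite subKr; apply; lra.
  apply: le_trans.
  have := ler_wpM2l (ler0n R t) be; move: epst; rewrite -natr1; lra.
have b01 : 0 <= b <= 1 by rewrite b0 b1.
have := arm_bound_decay edge_prob01 t b01 h; apply: contraTT; rewrite -!ltNge => big.
have c0 := arm_bound_ge0 n edge_prob01 t.
set c := arm_bound n p t in big c0 *.
have t0 := ler0n R t.
have : c * (3^-1 * (1 + t%:R / 2)) <= c * (b ^+ t * (1 + t%:R / 2)).
  by apply: ler_wpM2l => //; apply: ler_wpM2r => //; lra.
apply: lt_le_trans; move: big; rewrite -natr1; nra.
Qed.

Let edges := enum (pairs n).
Let num (E : {set {set 'I_n}}) : R := (max_packing (3 * t.+1) E)%:R.

Lemma expect_max_packing : expect p edges num <= 144 * n%:R / t.+1%:R ^+ 3.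
Proof.
have p01 := edge_prob01; case/andP: eps01 => e0 e1.
have t0 : 0 < t.+1%:R :> R by rewrite ltr0n.
have n0 := vertices_gt0.
have h : t.+1%:R * expect p edges num <= n%:R * ((n%:R * p) * arm_bound n p t) ^+ 2.
  rewrite -(expectZ p01).
  apply: (@le_trans _ _ (expect p edges (fun E => \sum_v (two_arms t v E)%:R))).
    apply: expect_le => // E _; rewrite -natrM -natr_sum ler_nat.
    exact: max_packing_two_arms.
  rewrite (expect_sum p01).
  apply: (@le_trans _ _ (\sum_(v < n) (n%:R * p * arm_bound n p t) ^+ 2)).
    by apply: ler_sum => v _; apply: expect_two_arms => //; exact: enum_uniq.
  by rewrite sumr_const card_ord -[leLHS]mulr_natl.
rewrite ler_pdivlMr ?exprn_gt0 //.
have c0 := arm_bound_ge0 n p01 t; have c6 := near_critical_arm_bound.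
set c := arm_bound n p t in h c0 c6.
rewrite edge_prob_mul in h.
(* Here 12 = 2 * 6, from 1 + eps <= 2 and the arm bound; its square is the constant 144. *)
have ec : (1 + eps) * c * t.+1%:R <= 12 by nra.
have ec0 : 0 <= (1 + eps) * c * t.+1%:R.
  by apply: mulr_ge0; [apply: mulr_ge0 => //; lra|exact: ltW].
have sq : ((1 + eps) * c * t.+1%:R) ^+ 2 <= 144 by nra.
have -> : expect p edges num * t.+1%:R ^+ 3 =
  t.+1%:R * expect p edges num * t.+1%:R ^+ 2 by lra.
apply: (@le_trans _ _ (n%:R * ((1 + eps) * c * t.+1%:R) ^+ 2)).
  rewrite exprMn [leRHS]mulrA; apply: ler_wpM2r; [exact: sqr_ge0|exact: h].
by rewrite [leRHS]mulrC ler_wpM2l // ltW.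
Qed.

Lemma max_packing_tail :
  1 - t.+1%:R ^+ 6 / n%:R <=
  expect p edges (fun E => (num E <= 2 * (144 * n%:R / t.+1%:R ^+ 3))%R%:R).
Proof.
have p01 := edge_prob01; case/andP: eps01 => e0 e1; have /andP[p0 p1] := p01.
have t0 : 0 < t.+1%:R :> R by rewrite ltr0n.
have n0 := vertices_gt0.
pose tau : R := 144 * n%:R / t.+1%:R ^+ 3.
have tau0 : 0 < tau by rewrite divr_gt0 ?exprn_gt0 // mulr_gt0.
(* There are at most n^2 / 2 pairs, so Efron-Stein bounds the variance by (n^2 / 2) p = n (1 + eps)
   / 2 <= n. *)
have var : expect p edges (fun E => num E ^+ 2) - expect p edges num ^+ 2 <= n%:R.
  apply: le_trans (efron_stein p01 _ _) _.
    move=> e E; rewrite /num.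
    have h1 := max_packing_setU1 e E (isT : (0 < 3 * t.+1)%N).
    have h2 := max_packingS (isT : (0 < 3 * t.+1)%N) (finset.subsetUr [set e] E).
    move: h1 h2; set a := max_packing _ _; set b := max_packing _ _ => h1 h2.
    have h1' : a%:R <= b%:R + 1 :> R by rewrite natr1 ler_nat.
    have h2' : b%:R <= a%:R :> R by rewrite ler_nat.
    by rewrite ler_norml; lra.
  rewrite /edges -cardE.
  have : (#|pairs n| * 2 <= n * n)%N by rewrite card_pairs leq_mul2l leq_pred orbT.
  rewrite -(ler_nat R) !natrM => hp.
  have := ler_wpM2r p0 hp; rewrite -[leRHS]mulrA edge_prob_mul.
  have := ler_wpM2l (ltW n0) e1; lra.
have := expect_chebyshev p01 tau0 var.
(* The deviation [tau] equals the bound on the mean, so the failure probability is of order 1/n for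
   fixed [t]. *)
have tE : n%:R / tau ^+ 2 <= t.+1%:R ^+ 6 / n%:R.
  rewrite ler_pdivlMr // mulrAC ler_pdivrMr ?exprn_gt0 //.
  have -> : t.+1%:R ^+ 6 * tau ^+ 2 = (tau * t.+1%:R ^+ 3) ^+ 2.
    by move: tau {tau0} => u; lra.
  rewrite divfK ?gt_eqF ?exprn_gt0 // exprMn; nra.
move=> cheb; apply: le_trans (le_trans cheb _); first by lra.
apply: expect_le => // E _; rewrite ler_nat.
case: (boolP (num E <= expect p edges num + tau)) => // h.
rewrite (le_trans h) //.
have -> : 2 * (144 * n%:R / t.+1%:R ^+ 3) = tau + tau.
  by rewrite -/tau mulr_natl mulr2n.
by rewrite lerD2r; exact: expect_max_packing.
Qed.

End Tail.

(* 256 * 243 = 6 * 288 * 6^2, kept as a product since the literal 62208 would be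
   expanded to a unary natural number. *)
Lemma long_paths_cover_max_packing (R : realType) n t (l : R)
    (E : {set {set 'I_n}}) :
  3 * t.+1%:R <= l < 6 * t.+1%:R ->
  (max_packing (3 * t.+1) E)%:R <= 2 * (144 * n%:R / t.+1%:R ^+ 3) :> R ->
  long_paths_cover_at_most l (256 * 243 / l ^+ 2 * n%:R) E.
Proof.
move=> /andP[tl lt] hX S dS lS.
have t0 : 0 < t.+1%:R :> R by rewrite ltr0n.
have : (#|covered S| <= 2 * (3 * t.+1) * max_packing (3 * t.+1) E)%N.
  apply: covered_le => // s sS; rewrite -(ler_nat R) natrM.
  exact: le_trans tl (lS _ sS).
rewrite -(ler_nat R) !natrM => /le_trans; apply.
have l0 : 0 < l by lra.
apply: (@le_trans _ _ (1728 * n%:R / t.+1%:R ^+ 2)).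
  move: hX; rewrite mulrA !ler_pdivlMr ?exprn_gt0 //.
  set X := (max_packing _ _)%:R; lra.
rewrite [leRHS]mulrAC; rewrite ler_pdivrMr ?exprn_gt0 //.
rewrite [leRHS]mulrAC ler_pdivlMr ?exprn_gt0 //.
have : l ^+ 2 <= 36 * t.+1%:R ^+ 2 by nra.
by move/(ler_wpM2l (ler0n R n)); lra.
Qed.

(** * Convergence of the probability to 1 *)

Local Open Scope classical_set_scope.

Theorem theorem1p3 (R : realType) :
  exists eps0 : R, 0 < eps0 /\
  exists D : R, 0 < D /\
  forall delta eps : R, 0 < delta <= 1 -> 0 < eps < eps0 ->
    (fun n : nat =>
       gnp_prob ((1 + eps) / n%:R)
         (@long_paths_cover_at_most R n (delta / eps)
            (D * eps ^+ 2 * delta ^- 2 * n%:R)))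
      @ \oo --> (1 : R).
Proof.
exists 1; split=> //; exists (256 * 243); split; first by rewrite mulr_gt0.
move=> delta eps /andP[d0 d1] /andP[e0 e1].
set l := delta / eps.
have l0 : 0 < l by exact: divr_gt0.
have -> : 256 * 243 * eps ^+ 2 * delta ^- 2 = 256 * 243 / l ^+ 2.
  by rewrite -mulrA; congr (_ * _); rewrite /l expr_div_n invf_div.
have eps01 : 0 < eps <= 1 by rewrite e0 ltW.
(* It suffices that the failure probability is at most C / n with C independent of n. *)
have [C hC] : exists C : R, forall n, 3 / eps <= n%:R ->
    1 - C / n%:R <= expect ((1 + eps) / n%:R) (enum (pairs n))
      (fun E => `[< long_paths_cover_at_most l (256 * 243 / l ^+ 2 * n%:R) E >]%:R).
  (* For l < 3 the claimed bound is at least n, since D / l^2 >= D / 9 >= 1. *)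
  have [l3|l3] := ltP l 3.
    exists 0 => n hn; rewrite mul0r subr0.
    have p01 := edge_prob01 eps01 hn.
    rewrite -[leLHS](expect_cst ((1 + eps) / n%:R) (enum (pairs n))).
    apply: expect_le => // E _; rewrite ler1n lt0b; apply/asboolP => S _ _.
    apply: (@le_trans _ _ n%:R).
      by rewrite ler_nat -[leqRHS](card_ord n) max_card.
    rewrite ler_peMl // ler_pdivlMr ?exprn_gt0 //; nra.
  (* Take [t.+1] to be the integer part of l / 3; as l >= 3 it is positive, and l / 3 < t + 2 <= 2
     (t + 1). *)
  have [t tl] : exists t, 3 * t.+1%:R <= l < 6 * t.+1%:R.
    have /truncn_itv/andP[] : 0 <= l / 3 by lra.
    case: (Num.truncn _) => [|t]; first by lra.
    move=> h1 h2; exists t; apply/andP; split; first lra.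
    have : 0 <= t%:R :> R by [].
    move: h2; rewrite -[t.+2%:R]natr1 -[t.+1%:R]natr1; lra.
  exists (t.+1%:R ^+ 6) => n hn.
  have p01 := edge_prob01 eps01 hn.
  (* Indeed eps (t + 1) <= eps l / 3 = delta / 3, and delta <= 1. *)
  have epst : eps * t.+1%:R <= 3^-1.
    have : eps * l = delta by rewrite mulrC divfK // gt_eqF.
    case/andP: tl => tl _; have := ler_wpM2l (ltW e0) tl; lra.
  apply: (le_trans (max_packing_tail eps01 epst hn)).
  apply: expect_le => // E _; rewrite ler_nat.
  case: (boolP (_ <= _)) => // h.
  by rewrite lt0b; apply/asboolP; exact: long_paths_cover_max_packing h.
apply/cvgrPdist_le => r r0; near=> n.
have hn : 3 / eps <= n%:R by near: n; exact: nbhs_infty_ger.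
have p01 := edge_prob01 eps01 hn.
have n0 := vertices_gt0 eps01 hn.
rewrite gnp_prob_expect // ger0_norm; last first.
  rewrite subr_ge0 -[leRHS](expect_cst ((1 + eps) / n%:R) (enum (pairs n))).
  by apply: expect_le => // E _; rewrite lern1 leq_b1.
rewrite lerBlDr -lerBlDl; apply: le_trans (hC n hn); rewrite lerD2l lerN2.
rewrite ler_pdivrMr // mulrC -ler_pdivrMr //.
by near: n; exact: nbhs_infty_ger.
Unshelve. all: by end_near.
Qed.
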